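(* For all integers $n$ and $k$ with $2\le k\le n-1$, $C_k(K_n)=n-k+2$, where $K_n$ is the complete graph on $n$ vertices.
   Context: All graphs are finite, simple and undirected. For an integer $k\ge 1$, a set $S\subseteq V(G)$ is a $k$-dominating set of $G$ if every vertex of $V(G)\setminus S$ has at least $k$ neighbours in $S$. Two sets $U_1,U_2\subseteq V(G)$ form a $k$-coalition if neither $U_1$ nor $U_2$ is a $k$-dominating set of $G$, but $U_1\cup U_2$ is. A $k$-coalition partition of $G$ is a partition $\Theta$ of $V(G)$ into nonempty sets such that every set of $\Theta$ either is a $k$-dominating set of $G$ with exactly $k$ elements, or forms a $k$-coalition with some other set of $\Theta$. The $k$-coalition number $C_k(G)$ is the maximum number of sets in a $k$-coalition partition of $G$. *)

(* Defs.v *)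
From mathcomp Require Import all_boot.

Set Implicit Arguments.
Unset Strict Implicit.
Unset Printing Implicit Defensive.

Record sgraph := SGraph {
  vertex :> finType;
  adj : rel vertex;
  adj_sym : symmetric adj;
  adj_irrefl : irreflexive adj
}.

Section KCoalition.

Variables (G : sgraph) (k : nat).
Implicit Types (S U : {set G}) (Theta : {set {set G}}).

Definition k_dominating S : bool :=
  [forall v in ~: S, k <= #|[set u in S | adj v u]|].

Definition k_coalition U1 U2 : bool :=
  [&& ~~ k_dominating U1, ~~ k_dominating U2 & k_dominating (U1 :|: U2)].

(* MathComp's [partition] already requires the blocks to be nonempty. *)
Definition k_coalition_partition Theta : bool :=
  partition Theta [set: G] &&
  [forall U in Theta,
     (k_dominating U && (#|U| == k)) ||
     [exists W in Theta, (W != U) && k_coalition U W]].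

(* The maximum over an empty family is 0, so C_k(G) = 0 when G has no
   k-coalition partition; a positive value is always attained. *)
Definition k_coalition_number : nat :=
  \max_(Theta : {set {set G}} | k_coalition_partition Theta) #|Theta|.

End KCoalition.

Lemma neq_sym (T : finType) : symmetric (fun x y : T => x != y).
Proof. by move=> x y; rewrite eq_sym. Qed.

Lemma neq_irrefl (T : finType) : irreflexive (fun x y : T => x != y).
Proof. by move=> x; rewrite eqxx. Qed.

Definition complete_graph (n : nat) : sgraph :=
  SGraph (@neq_sym 'I_n) (@neq_irrefl 'I_n).

(* Main.v *)
Require Import Defs.
From mathcomp Require Import all_boot.
From mathcomp Require Import zify.

Set Implicit Arguments.
Unset Strict Implicit.
Unset Printing Implicit Defensive.

(** In K_n a set is k-dominating exactly when it has at least k elements. So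
    for every block of a k-coalition partition, either the block alone or its
    union with one partner has at least k elements, and the remaining blocks
    partition at most n - k vertices. Equality is attained by one block of size
    k - 1 together with singletons. *)

Lemma partition_card_leq (T : finType) (P : {set {set T}}) (D : {set T}) :
  partition P D -> #|P| <= #|D|.
Proof.
move=> PD; rewrite (card_partition PD) -sum1_card; apply: leq_sum => A PA.
by rewrite card_gt0; apply: contraTneq PA => ->; case/and3P: PD.
Qed.

(** The blocks other than [B] partition [D :\: B], so there are at most as many of them as vertices
    left. *)
Lemma partition_card_leqD1 (T : finType) (P : {set {set T}}) (D B : {set T}) :
  partition P D -> B \in P -> #|P| <= #|D :\: B|.+1.
Proof.
move=> PD PB; rewrite (cardsD1 B) PB ltnS.
exact: partition_card_leq (partitionD1 PD PB).
Qed.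

Lemma singletons_partition (T : finType) (D : {set T}) :
  partition [set [set x] | x in D] D.
Proof.
have disjB : {in D &, forall x y : T, y != x -> [disjoint [set x] & [set y]]}.
  by move=> x y _ _ yx; rewrite disjoints1 inE eq_sym.
have [|] := indexed_partition disjB.
  by move=> x _; apply/set0Pn; exists x; rewrite inE.
suff -> : cover [set [set x] | x in D] = D by [].
rewrite cover_imset; apply/setP=> x; apply/bigcupP/idP => [[y Dy]|Dx].
  by move/set1P->.
by exists x; rewrite ?inE.
Qed.

Section CompleteGraph.

Variables n k : nat.
Local Notation K := (complete_graph n).
Implicit Types (S : {set K}) (Theta : {set {set K}}).

(** A vertex outside [S] is adjacent to all of [S], so it has exactly [#|S|] neighbours there. If
    [S] is everything, domination is vacuous and the size bound comes from [k <= n]. *)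
Lemma k_dominating_complete S : k <= n -> k_dominating k S = (k <= #|S|).
Proof.
move=> kn.
have nbrs v : v \notin S -> [set u in S | adj v u] = S.
  move=> vS; apply/setP=> u; rewrite inE /=.
  by case uS: (u \in S) => //=; apply: contraNneq vS => ->.
apply/forall_inP/idP => [domS|kS v]; last by rewrite inE => /nbrs->.
have [S0|/set0Pn[v vS]] := eqVneq (~: S) set0.
  by rewrite -[S]setCK S0 setC0 cardsT card_ord.
by have := domS v vS; rewrite nbrs // -in_setC.
Qed.

Lemma k_coalition_partition_complete_leq Theta :
  k <= n -> 0 < k -> k_coalition_partition k Theta -> #|Theta| <= n - k + 2.
Proof.
move=> kn k_gt0 /andP[partT /forall_inP coalT].
have [->|/set0Pn[U TU]] := eqVneq Theta set0; first by rewrite cards0.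
have sizeD S : #|[set: K] :\: S| = n - #|S|.
  by rewrite cardsDS ?subsetT // cardsT card_ord.
case/orP: (coalT U TU) => [/andP[_ /eqP Uk]|/exists_inP[W TW /andP[WU]]].
  (* A dominating block of size [k] even gives the bound [n - k + 1]. *)
  by apply: leq_trans (partition_card_leqD1 partT TU) _; rewrite sizeD Uk; lia.
case/and3P=> _ _; rewrite k_dominating_complete // => kUW.
have TUW : W \in Theta :\ U by rewrite !inE WU.
(* The blocks [U] and [W] account for the summand 2; the others live on the at most [n - k] vertices
   outside [U :|: W]. *)
rewrite (cardsD1 U) TU add1n addn2 ltnS.
apply: leq_trans (partition_card_leqD1 (partitionD1 partT TU) TUW) _.
by rewrite setDDl sizeD ltnS leq_sub2l.
Qed.

Lemma k_coalition_partition_complete_attained :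
  2 <= k < n ->
  exists2 Theta, @k_coalition_partition K k Theta & #|Theta| = n - k + 2.
Proof.
move=> /andP[k2 kn]; have kn' := ltnW kn.
have k1n : k - 1 <= n by lia.
pose A : {set K} := [set widen_ord k1n i | i : 'I_(k - 1)].
have cardA : #|A| = k - 1.
  by rewrite card_imset ?card_ord // => i j /(congr1 val) /= /val_inj.
have cardAC : #|~: A| = n - k + 1.
  by have := cardsC A; rewrite cardA card_ord; lia.
pose Sing := [set [set x] | x in ~: A].
have partS : partition Sing (~: A) by apply: singletons_partition.
(* Here [2 <= k] enters: [A] must be a legitimate block. *)
have A0 : A != set0 by rewrite -card_gt0 cardA; lia.
have ASing : A \notin Sing.
  apply: contra A0 => /imsetP[x xAC AE]; move: xAC.
  by rewrite inE {1}AE set11.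
(* The sizes [k - 1] and 1 are both below [k], and the disjoint union has size exactly [k]. *)
have coalA x : x \notin A -> k_coalition k A [set x].
  move=> xA; rewrite /k_coalition !k_dominating_complete // setUC cardsU1 xA.
  by rewrite cards1 cardA; lia.
exists (A |: Sing); last first.
  by rewrite cardsU1 ASing card_imset ?cardAC; [lia|apply: set1_inj].
apply/andP; split.
  by rewrite -(setUCr A) partitionU1 // disjoints_subset setCK.
apply/forall_inP=> U /setU1P[->|/imsetP[x]]; last rewrite inE => xA ->.
  (* Any singleton outside [A] serves as partner of [A]; conversely [A] is the partner of every
     singleton. *)
  have /card_gt0P[x xAC] : 0 < #|~: A| by rewrite cardAC addn1.
  apply/orP; right; apply/exists_inP; exists [set x].
    by rewrite setU1r // imset_f.
  rewrite coalA -?in_setC // andbT.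
  by apply: contraNneq ASing => <-; rewrite imset_f.
apply/orP; right; apply/exists_inP; exists A; first exact: setU11.
apply/andP; split.
  by apply: contraNneq xA => ->; rewrite set11.
by have := coalA x xA; rewrite /k_coalition setUC => /and3P[-> -> ->].
Qed.

End CompleteGraph.

Theorem theorem5 (n k : nat) (hk : 2 <= k <= n - 1) :
  k_coalition_number (complete_graph n) k = n - k + 2.
Proof.
have kn : 2 <= k < n by lia.
apply/eqP; rewrite eqn_leq; apply/andP; split.
  by apply/bigmax_leqP=> Theta; apply: k_coalition_partition_complete_leq; lia.
have [Theta coalT <-] := k_coalition_partition_complete_attained kn.
exact: leq_bigmax_cond.
Qed.
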